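(* Let $\Gamma$ and the extended group $\hat\Gamma_{(0,-\infty)}$ be as in the context, fix a section of $\pi$ (so $\Gamma\cong\mathbb Z\oplus\mathbb Z$, $n\oplus p$, $\pi(n\oplus p)=n$), and identify integer quadruples $(a,b,c,m)$ with elements of $\hat\Gamma_{(0,-\infty)}$ via the bijection $$(a,b,c,m)\mapsto\Big(\big((b\oplus a),\ -c+d_b\big),\ m\Big),$$ with $d_b$ as in the context. Under this identification the group law of $\hat\Gamma_{(0,-\infty)}$ is $$(a_1,b_1,c_1,m_1)(a_2,b_2,c_2,m_2)=\Big(a_1+a_2+m_1b_2,\ b_1+b_2,\ c_1+c_2+a_1b_2+\tfrac12 b_2(b_2-1)m_1,\ m_1+m_2\Big).$$
   Context: $\Gamma$ is an abelian group with a fixed exact sequence $0\to\mathbb Z\to\Gamma\xrightarrow{\pi}\mathbb Z\to0$; fibres $\pi^{-1}(n)$ are $\mathbb Z$-torsors via $\ker\pi=\mathbb Z$ (under the chosen splitting, $\ker\pi=0\oplus\mathbb Z$). Order on $\Gamma$: $\gamma_1>\gamma_2$ iff $\pi(\gamma_1)>\pi(\gamma_2)$, or equal and $\gamma_1-\gamma_2\in\ker\pi$ positive. $\breve\Gamma=\Gamma\sqcup\pi(\Gamma)$, elements of $\pi(\Gamma)$ written $(n,-\infty)$; order: compare $\breve\pi$ first ($\breve\pi=\pi$ on $\Gamma$, $\breve\pi(n,-\infty)=n$), $(n,-\infty)$ below all of $\pi^{-1}(n)$, order of $\Gamma$ on fibres. $\Gamma$ acts on $\breve\Gamma$ by addition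 on $\Gamma$ and $\beta\circ(n,-\infty)=(\pi(\beta)+n,-\infty)$. Torsors: $A\sim B$ means finite symmetric difference. For $\alpha\ge\beta$, $R_{\alpha,\beta}=\{\gamma\in\Gamma:\alpha>\gamma\ge\beta\}$; $Y$ one point of each nonempty $\pi^{-1}(n)\cap R_{\alpha,\beta}$; $\tau$ = subsets $A\subset R_{\alpha,\beta}$ with $A\sim(\mathbb Z_{\ge0}+Y)\cap R_{\alpha,\beta}$; $[\alpha,\beta]$ = $\mathbb Z$-torsor of maps $d:\tau\to\mathbb Z$ with $d(A_2)=d(A_1)+|A_2\setminus A_1|$ for $A_1\subset A_2$, $(a+d)(A)=d(A)+a$ ($=\mathbb Z$ if $R_{\alpha,\beta}=\emptyset$); for $\alpha\le\beta$, $[\alpha,\beta]=[\beta,\alpha]^*$ (same set, opposite action). Canonical associative composition isomorphisms $[\alpha,\alpha]\cong\mathbb Z$, $[\alpha,\beta]\otimes[\beta,\delta]\cong[\alpha,\delta]$ ($h_1\otimes h_2$): for $\alpha\ge\beta\ge\delta$, $(d_1\otimes d_2)(A_1\sqcup A_2)=d_1(A_1)+d_2(A_2)$, other orderings via $P\otimes P^*\to\mathbb Z$, $(p,q)\mapsto a$ with $p=q+a$. For $\phi\in\Gamma$, $\phi(h)$ denotes the image of $h$ under $[\alpha,\beta]\to[\phi\circ\alpha,\phi\circ\beta]$, $d\mapsto(A\mapsto d(A-\phi))$. For $m\in\mathbb Z$ let $m\diamond\gamma=\gamma+m\pi(\gamma)$ ($\gamma\in\Gamma$, $m\pi(\gamma)\in\ker\pi$),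 $m\diamond(n,-\infty)=(n,-\infty)$; it induces $m(\cdot):[\alpha,\beta]\to[m\diamond\alpha,m\diamond\beta]$, $d\mapsto d\circ(m\diamond)^{-1}$. $\tilde\Gamma_{\alpha}=\{(\beta,h):\beta\in\Gamma,\ h\in[\alpha,\beta\circ\alpha]\}$ with $(\beta_1,h_1)(\beta_2,h_2)=(\beta_1+\beta_2,h_1\otimes\beta_1(h_2))$. For $\alpha=(0,-\infty)$ (fixed by all $m\diamond$), $\mathbb Z$ acts on $\tilde\Gamma_{(0,-\infty)}$ by $m(\beta,h)=(m\diamond\beta,m(h))$, and $\hat\Gamma_{(0,-\infty)}=\tilde\Gamma_{(0,-\infty)}\rtimes\mathbb Z$ with $(f_1,m_1)(f_2,m_2)=(f_1\,m_1(f_2),m_1+m_2)$. The elements $d_b\in[(0,-\infty),(b,-\infty)]$: $d_0=0$; for $b<0$, $d_b$ is the unique element with $d_b\big(\bigcup_{b\le n\le-1}(n\oplus\mathbb Z_{\ge0})\big)=0$; for $b>0$, $d_b$ is the unique element with $d_b\otimes(b\oplus0)(d_{-b})=0\in[(0,-\infty),(0,-\infty)]=\mathbb Z$. *)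

(* Defs.v *)
From HB Require Import structures.
From mathcomp Require Import all_boot all_order all_algebra.
From mathcomp Require Import finmap zify.
From mathcomp Require Import boolp classical_sets functions cardinality.

Set Implicit Arguments.
Unset Strict Implicit.
Unset Printing Implicit Defensive.

Import Order.TTheory GRing.Theory Num.Theory.
Local Open Scope classical_set_scope.
Local Open Scope ring_scope.

Record extension := Extension {
  ext_group :> zmodType;
  inc : {additive int -> ext_group};
  prj : {additive ext_group -> int};
  inc_inj : injective inc;
  prj_surj : forall n : int, exists g : ext_group, prj g = n;
  ext_exact : forall g : ext_group, prj g = 0 <-> exists p : int, g = inc p }.

Record splitting (G : extension) := Splitting {
  spl_fun :> {additive int -> G};
  splK : forall n : int, prj G (spl_fun n) = n }.

Definition oplus (G : extension) (s : splitting G) (n p : int) : G :=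
  s n + inc G p.

(* [MInf n] is (n, -oo); its index ranges over all of [int] because [prj] is
   surjective. *)
Inductive breve (G : extension) : Type :=
| Fin of G
| MInf of int.
Arguments MInf {G} n.

Section Definitions.
Context {G : extension}.
Implicit Types (g h : G) (a b c : breve G) (A B Y : set G).

Definition gltG g h : Prop :=
  prj G g < prj G h \/
  prj G g = prj G h /\ exists2 p : int, 0 < p & h - g = inc G p.

Definition bprj a : int := match a with Fin g => prj G g | MInf n => n end.

Definition ltB a b : Prop :=
  bprj a < bprj b \/
  bprj a = bprj b /\ match a, b with
                     | Fin g, Fin h => gltG g h
                     | MInf _, Fin _ => True
                     | _, MInf _ => False
                     end.

Definition leB a b : Prop := a = b \/ ltB a b.

Definition bact g a : breve G :=
  match a with Fin h => Fin (g + h) | MInf n => MInf (prj G g + n) end.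

Definition gdiam (m : int) g : G := g + inc G (m * prj G g).

Definition bdiam (m : int) a : breve G :=
  match a with Fin g => Fin (gdiam m g) | MInf n => MInf n end.

Definition commens A B : Prop := finite_set ((A `\` B) `|` (B `\` A)).

Definition card A : int := Posz #|` fset_set A |%fset.

Definition segment a b : set G := [set g | ltB (Fin g) a /\ leB b (Fin g)].

Definition transversal (R Y : set G) : Prop :=
  Y `<=` R /\ forall g, R g -> exists! y, Y y /\ prj G y = prj G g.

Definition upward Y : set G :=
  [set g | exists y p, [/\ Y y, 0 <= p :> int & g = inc G p + y]].

Definition tau a b A : Prop :=
  A `<=` segment a b /\
  exists2 Y, transversal (segment a b) Y
           & commens A (upward Y `&` segment a b).

(* [a, b] and [b, a] have the same underlying set, formed from the segment
   between the smaller and the larger of the two. *)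
Definition bmax a b := if `[< leB b a >] then a else b.
Definition bmin a b := if `[< leB b a >] then b else a.

(* A map tau -> Z is encoded by its extension by zero to all subsets of G. *)
Definition dimension_map a b (d : set G -> int) : Prop :=
  (forall A, ~ tau a b A -> d A = 0) /\
  (forall A1 A2, tau a b A1 -> tau a b A2 -> A1 `<=` A2 ->
     d A2 = d A1 + card (A2 `\` A1)).

Record tors a b := Tors {
  tfun :> set G -> int;
  torsP : dimension_map (bmax a b) (bmin a b) tfun }.

(* Since tau a a = {set0}, an element of [a, a] amounts to its value at set0. *)
Definition tint a (h : tors a a) : int := h set0.

End Definitions.

Arguments tint {G a} h.

Section Order.
Context {G : extension}.
Implicit Types (g h : G) (a b c : breve G) (A B C Y : set G).

(* Auxiliary coordinates on G, from an arbitrary set-theoretic section. *)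
Definition gsec (n : int) : G := projT1 (cid (prj_surj G n)).
Lemma gsecK n : prj G (gsec n) = n.
Proof. exact: (projT2 (cid (prj_surj G n))). Qed.

Lemma gco_ex g : exists p : int, g - gsec (prj G g) = inc G p.
Proof. by apply/ext_exact; rewrite raddfB /= gsecK subrr. Qed.

Definition gco g : int := projT1 (cid (gco_ex g)).
Lemma gcoE g : g = inc G (gco g) + gsec (prj G g).
Proof.
by rewrite -(projT2 (cid (gco_ex g))) subrK.
Qed.

Lemma prj_inc p : prj G (inc G p) = 0.
Proof. by apply/ext_exact; exists p. Qed.

Lemma gco_inc g p : gco (inc G p + g) = p + gco g.
Proof.
apply: (@inc_inj G); apply: (addIr (gsec (prj G g))).
have := gcoE (inc G p + g); rewrite raddfD /= prj_inc add0r => <-.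
by rewrite raddfD /= -addrA -gcoE.
Qed.

Lemma gco_inj g h : prj G g = prj G h -> gco g = gco h -> g = h.
Proof. by move=> e1 e2; rewrite (gcoE g) (gcoE h) e1 e2. Qed.

Lemma gcoB g h : prj G g = prj G h -> h - g = inc G (gco h - gco g).
Proof.
move=> e; rewrite [in LHS](gcoE g) [in LHS](gcoE h) e opprD.
by rewrite addrACA subrr addr0 raddfB.
Qed.

Lemma gltGE g h : gltG g h <->
  (prj G g < prj G h \/ prj G g = prj G h /\ gco g < gco h).
Proof.
split=> [[?|[e [p p0 hp]]]|[?|[e l]]]; [by left| |by left|].
  right; split => //; move: hp; rewrite gcoB// => /inc_inj; lia.
by right; split => //; exists (gco h - gco g); [lia|rewrite gcoB].
Qed.

Lemma ltBE a b : ltB a b <-> bprj a < bprj b \/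
  bprj a = bprj b /\ match a, b with
                     | Fin g, Fin h => gco g < gco h
                     | MInf _, Fin _ => True
                     | _, MInf _ => False
                     end.
Proof.
rewrite /ltB; case: a => [g|n]; case: b => [h|m] //=.
by rewrite gltGE; lia.
Qed.

Lemma ltB_irr a : ~ ltB a a.
Proof. rewrite ltBE; case: a => [g|n] /=; lia. Qed.

Lemma ltB_trans a b c : ltB a b -> ltB b c -> ltB a c.
Proof.
rewrite !ltBE; case: a => [g|n]; case: b => [h|m]; case: c => [k|l] /=; lia.
Qed.

Lemma leBVlt a b : leB a b \/ ltB b a.
Proof.
rewrite /leB !ltBE; case: a => [g|n]; case: b => [h|m] /=; try lia.
- have [e|e] := pselect (prj G g = prj G h); last lia.
  have [e'|e'] := pselect (gco g = gco h); last lia.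
  by left; left; rewrite (gco_inj e e').
- have [->|e'] := pselect (n = m); last lia.
  by left; left.
Qed.

Lemma leB_ltNge a b : leB a b <-> ~ ltB b a.
Proof.
split; last by case: (leBVlt a b).
case=> [->|l l']; first exact: ltB_irr.
exact: (@ltB_irr a (ltB_trans l l')).
Qed.

Lemma leBb a b : `[< leB a b >] = ~~ `[< ltB b a >].
Proof. by apply/asboolP/asboolPn; rewrite leB_ltNge. Qed.

Lemma leBB a : leB a a. Proof. by left. Qed.

Lemma leB_anti a b : leB a b -> leB b a -> a = b.
Proof. by case=> // l /leB_ltNge. Qed.

Lemma leB_trans a b c : leB a b -> leB b c -> leB a c.
Proof.
case=> [->//|l] [<-|l']; [by right|by right; exact: ltB_trans l'].
Qed.

Lemma ltBW a b : ltB a b -> leB a b. Proof. by right. Qed.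

Lemma leB_ltB a b c : leB a b -> ltB b c -> ltB a c.
Proof. by case=> [->//|]; exact: ltB_trans. Qed.

Lemma ltB_leB a b c : ltB a b -> leB b c -> ltB a c.
Proof. by move=> l [<-//|]; exact: ltB_trans. Qed.

Lemma bmaxC a b : bmax a b = bmax b a.
Proof.
rewrite /bmax; case: asboolP => h1; case: asboolP => h2 //.
  exact: leB_anti.
by case: (leBVlt b a) => // /ltBW.
Qed.

Lemma bminC a b : bmin a b = bmin b a.
Proof.
rewrite /bmin; case: asboolP => h1; case: asboolP => h2 //.
  exact: leB_anti.
by case: (leBVlt b a) => // /ltBW.
Qed.

Lemma bmax_l a b : leB b a -> bmax a b = a.
Proof. by move=> l; rewrite /bmax asboolT. Qed.
Lemma bmin_l a b : leB b a -> bmin a b = b.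
Proof. by move=> l; rewrite /bmin asboolT. Qed.
Lemma bmax_r a b : leB a b -> bmax a b = b.
Proof. by rewrite bmaxC; exact: bmax_l. Qed.
Lemma bmin_r a b : leB a b -> bmin a b = a.
Proof. by rewrite bminC; exact: bmin_l. Qed.

Lemma segment_prj a b g : segment a b g -> bprj b <= prj G g <= bprj a.
Proof.
move=> [/ltBE l1 l2].
have : bprj b <= prj G g.
  by case: l2 => [->//|/ltBE]; case: (b) => [h|n] /=; lia.
by move: l1; case: (a) => [h|n] /=; lia.
Qed.

Lemma finite_int (l u : int) : finite_set [set n : int | l <= n < u].
Proof.
apply: (@sub_finite_set _ _ ((fun i : nat => l + i%:Z) @` `I_(`|u - l|%N))).
  by move=> n /= /andP[h1 h2]; exists `|n - l|%N; rewrite /=; lia.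
exact/finite_image/finite_II.
Qed.

Lemma finite_fibrewise a b A (l u : int -> int) : A `<=` segment a b ->
  (forall g, A g -> l (prj G g) <= gco g < u (prj G g)) -> finite_set A.
Proof.
move=> sA lu.
apply: (@sub_finite_set _ _ (\bigcup_(n in [set n : int | bprj b <= n < bprj a + 1])
   (fun p => inc G p + gsec n) @` [set p : int | l n <= p < u n])).
  move=> g Ag; exists (prj G g) => /=.
    by have := segment_prj (sA _ Ag); lia.
  by exists (gco g); [exact: lu|rewrite -gcoE].
apply: bigcup_finite; first exact: finite_int.
by move=> n _; exact/finite_image/finite_int.
Qed.

Lemma commensP A B : commens A B <-> finite_set (A `\` B) /\ finite_set (B `\` A).
Proof. by rewrite /commens finite_setU. Qed.

Lemma commens_refl A : commens A A.
Proof. by apply/commensP; rewrite setDv; split; exact: finite_set0. Qed.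

Lemma commens_sym A B : commens A B -> commens B A.
Proof. by rewrite !commensP => -[]. Qed.

Lemma commens_trans A B C : commens A B -> commens B C -> commens A C.
Proof.
have sub X Y Z : X `\` Z `<=` (X `\` Y) `|` (Y `\` Z).
  by move=> g [Xg Zg]; have [Yg|Yg] := pselect (Y g); [right|left].
rewrite !commensP => -[f1 f2] [f3 f4]; split.
  by apply: sub_finite_set (sub A B C) _; rewrite finite_setU.
by apply: sub_finite_set (sub C B A) _; rewrite finite_setU.
Qed.

Lemma commensI A B C : commens A B -> commens (A `&` C) (B `&` C).
Proof.
rewrite !commensP => -[f1 f2]; split.
  by apply: sub_finite_set f1 => g [[? ?] h]; split=> // ?; apply: h.
by apply: sub_finite_set f2 => g [[? ?] h]; split=> // ?; apply: h.
Qed.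

Lemma commensU A B C D : commens A B -> commens C D ->
  commens (A `|` C) (B `|` D).
Proof.
rewrite !commensP => -[f1 f2] [f3 f4]; split.
  apply: (@sub_finite_set _ _ ((A `\` B) `|` (C `\` D))); last by rewrite finite_setU.
  by move=> g [[?|?] h]; [left|right]; split=> // ?; apply: h; [left|right].
apply: (@sub_finite_set _ _ ((B `\` A) `|` (D `\` C))); last by rewrite finite_setU.
by move=> g [[?|?] h]; [left|right]; split=> // ?; apply: h; [left|right].
Qed.

Definition halves : set G := [set g | 0 <= gco g].

Lemma upward_commens a b Y : transversal (segment a b) Y ->
  commens (upward Y `&` segment a b) (halves `&` segment a b).
Proof.
move=> [sY trY].
pose y n : int := gco (xget 0 [set y | Y y /\ prj G y = n]).
have upE g : segment a b g -> upward Y g <-> y (prj G g) <= gco g.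
  move=> sg; rewrite /y; have [z [[Yz pz] uz]] := trY _ sg.
  case: xgetP => [x _ [Yx px]|/(_ z)]; last by case.
  split=> [[w [p [Yw p0 eg]]]|le].
    have pw : prj G w = prj G g by rewrite eg raddfD /= prj_inc add0r.
    have -> : x = w by rewrite -(uz x) // -(uz w).
    by rewrite eg gco_inc; lia.
  exists x, (gco g - gco x); split=> //; first lia.
  apply: gco_inj; first by rewrite raddfD /= prj_inc add0r px.
  by rewrite gco_inc; lia.
apply/commensP; split.
  apply: (@finite_fibrewise a b _ y (fun=> 0)).
    by move=> g [[]].
  move=> g [[/upE ug sg] hg]; rewrite ug//= ltNge; apply/negP => h0.
  exact: hg.
apply: (@finite_fibrewise a b _ (fun=> 0) y).
  by move=> g [[]].
move=> g [[hg sg] ug]; apply/andP; split => //; rewrite ltNge; apply/negP => h0.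
by apply: ug; split => //; apply/upE.
Qed.

Lemma transversal_ex a b : exists Y, transversal (segment a b) Y.
Proof.
pose f n := xget 0 [set y | segment a b y /\ prj G y = n].
have fE g : segment a b g -> segment a b (f (prj G g)) /\ prj G (f (prj G g)) = prj G g.
  by move=> sg; rewrite /f; case: xgetP => [x _ []|/(_ g)]//; case.
exists [set y | segment a b y /\ y = f (prj G y)]; split; first by move=> y [].
move=> g /fE[h1 h2]; exists (f (prj G g)); split.
  by split=> //; split=> //; rewrite h2.
by move=> z [[sz ez] pz]; rewrite ez pz.
Qed.

Lemma tauE a b A : tau a b A <->
  A `<=` segment a b /\ commens A (halves `&` segment a b).
Proof.
split=> -[sA].
  by move=> [Y /upward_commens cY cA]; split=> //; exact: commens_trans cY.
move=> cA; split=> //; have [Y tY] := transversal_ex a b; exists Y => //.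
exact/(commens_trans cA)/commens_sym/upward_commens.
Qed.

Lemma tau_ref a b : tau a b (halves `&` segment a b).
Proof. by apply/tauE; split; [exact: subIsetr|exact: commens_refl]. Qed.

Lemma segmentU a b c : leB b a -> leB c b ->
  segment a c = segment a b `|` segment b c.
Proof.
move=> ba cb; rewrite eqEsubset; split=> g /=.
  move=> [l1 l2]; case: (leBVlt b (Fin g)) => l; [by left|by right].
by move=> [[l1 l2]|[l1 l2]]; split=> //;
  [exact: leB_trans l2|exact: ltB_leB ba].
Qed.

Lemma segmentI a b c : segment a b `&` segment b c = set0.
Proof.
rewrite -subset0 => g [[_ l1] [l2 _]].
exact: (@ltB_irr b (leB_ltB l1 l2)).
Qed.

Lemma segmentaa a : segment a a = set0.
Proof.
by rewrite -subset0 => g [l1 l2]; exact: (@ltB_irr a (leB_ltB l2 l1)).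
Qed.

Lemma tauU a b c A1 A2 : leB b a -> leB c b ->
  tau a b A1 -> tau b c A2 -> tau a c (A1 `|` A2).
Proof.
move=> ba cb /tauE[s1 c1] /tauE[s2 c2]; apply/tauE.
rewrite (segmentU ba cb); split; first exact: setUSS.
by rewrite setIUr; exact: commensU.
Qed.

Lemma cardID A B : finite_set A -> card A = card (A `&` B) + card (A `\` B).
Proof.
move=> fA; rewrite /card.
have e1 : A `&` B = A `&` (A `&` B) by rewrite setIA setIid.
have e2 : A `\` B = A `\` (A `&` B).
  by rewrite eqEsubset; split=> g [Ag h]; split=> // Bg; apply: h; [case: Bg|].
have fAB : finite_set (A `&` B) by exact: finite_setIl.
rewrite {1}e1 e2 fset_setI// fset_setD// -PoszD.
by rewrite cardfsID.
Qed.

Lemma card_set0 : card (set0 : set G) = 0.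
Proof. by rewrite /card fset_set0 cardfs0. Qed.

Definition reldim A B : int := card (A `\` B) - card (B `\` A).

Lemma reldim_refl A : reldim A A = 0.
Proof. by rewrite /reldim subrr. Qed.

Lemma reldim_sub A B : A `<=` B -> reldim B A = card (B `\` A).
Proof.
by move=> AB; rewrite /reldim (_ : A `\` B = set0) ?card_set0 ?subr0 //
  setD_eq0.
Qed.

Lemma reldim_trans A B C : commens A B -> commens B C ->
  reldim A C = reldim A B + reldim B C.
Proof.
move=> cAB cBC; have cAC := commens_trans cAB cBC.
move: cAB cBC cAC => /commensP[f1 f2] /commensP[f3 f4] /commensP[f5 f6].
rewrite /reldim.
rewrite (cardID C f1) (cardID C f2) (cardID A f3) (cardID A f4).
rewrite (cardID B f5) (cardID B f6).
have E X Y Z : (X `\` Y) `&` Z = (Z `\` Y) `&` X.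
  by rewrite eqEsubset; split=> g [[]].
have E2 X Y Z : (X `\` Y) `\` Z = (X `\` Z) `\` Y.
  by rewrite eqEsubset; split=> g [[]].
rewrite (E C B A) (E C A B) (E B C A) (E2 B C A) (E2 C B A) (E2 A C B).
lia.
Qed.

Lemma preimage_imE (f f' : G -> G) A : cancel f f' -> cancel f' f ->
  f @^-1` A = f' @` A.
Proof.
move=> fK f'K; rewrite eqEsubset; split=> g /=; first by move=> Bg; exists (f g).
by move=> [h Bh <-]; rewrite f'K.
Qed.

Lemma finite_preimage_can (f f' : G -> G) A : cancel f f' -> cancel f' f ->
  finite_set A -> finite_set (f @^-1` A).
Proof. by move=> fK f'K fA; rewrite (preimage_imE _ fK)//; exact: finite_image. Qed.

Lemma card_preimage (f f' : G -> G) A : cancel f f' -> cancel f' f ->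
  finite_set A -> card (f @^-1` A) = card A.
Proof.
move=> fK f'K fA; rewrite /card (preimage_imE _ fK)//; congr Posz.
by rewrite fset_set_image // card_imfset //; exact: can_inj f'K.
Qed.

Lemma tau_commens a b A B : tau a b A -> tau a b B -> commens A B.
Proof. by move=> /tauE[_ cA] /tauE[_ /commens_sym]; exact: commens_trans. Qed.

Lemma tauI a b A B : tau a b A -> tau a b B -> tau a b (A `&` B).
Proof.
move=> tA tB; have /commensP[f1 f2] := tau_commens tA tB.
move: tA => /tauE[sA cA]; apply/tauE; split; first by move=> g [/sA].
apply: commens_trans cA; apply/commensP; split.
  by rewrite (_ : _ `\` _ = set0) ?setD_eq0;
    [exact: finite_set0|exact: subIsetl].
by apply: sub_finite_set f1 => g [Ag h]; split=> // Bg; apply: h.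
Qed.

Lemma dimension_mapE a b d A B : dimension_map a b d -> tau a b A -> tau a b B ->
  d A = d B + reldim A B.
Proof.
move=> [_ dP] tA tB; have tI := tauI tA tB.
rewrite (dP _ _ tI tA (@subIsetl _ _ _)) (dP _ _ tI tB (@subIsetr _ _ _)).
have E X Z : X `\` (X `&` Z) = X `\` Z.
  by rewrite eqEsubset; split=> g [Xg h]; split=> // Zg; apply: h; [|case: Zg].
by rewrite /reldim E setIC E; lia.
Qed.

Lemma dimension_map_mk a b (x : int) B : tau a b B ->
  dimension_map a b (fun A => if `[< tau a b A >] then x + reldim A B else 0).
Proof.
move=> tB; split=> [A nA|A1 A2 t1 t2 s12]; first by rewrite asboolF.
rewrite !asboolT// (reldim_trans (tau_commens t2 t1) (tau_commens t1 tB)).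
by rewrite (reldim_sub s12); lia.
Qed.

Lemma tau_preimage (f f' : G -> G) (k : int) a b a' b' A :
  cancel f f' -> cancel f' f ->
  (forall g, prj G (f g) = prj G g + k) ->
  (forall p g, f (inc G p + g) = inc G p + f g) ->
  (forall g, segment a' b' (f g) <-> segment a b g) ->
  tau a' b' A -> tau a b (f @^-1` A).
Proof.
move=> fK f'K fp fi fs [sA [Y [sY trY] cA]]; split.
  by move=> g /sA /fs.
exists (f @^-1` Y).
  split=> [g /sY /fs//|g /fs /trY[y [[Yy py] uy]]]; exists (f' y); split.
    rewrite /= f'K; split=> //; apply: (addIr k); rewrite -!fp f'K //.
  move=> z [Yz pz]; rewrite -(fK z); congr f'; apply: uy.
  by split=> //; rewrite !fp pz.
have -> : upward (f @^-1` Y) `&` segment a b = f @^-1` (upward Y `&` segment a' b').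
  rewrite eqEsubset; split=> g /= [ug /fs sg]; split=> //; move: ug => [y [p [Yy p0 e]]].
    by exists (f y), p; rewrite e fi.
  exists (f' y), p; rewrite /= f'K; split=> //.
  by rewrite -(fK g) e -{1}(f'K y) -fi fK.
by move: cA; rewrite /commens; exact: finite_preimage_can fK f'K.
Qed.

Lemma dimension_map_preimage (f f' : G -> G) (k : int) a b a' b' d :
  cancel f f' -> cancel f' f ->
  (forall g, prj G (f g) = prj G g + k) ->
  (forall p g, f (inc G p + g) = inc G p + f g) ->
  (forall g, segment a' b' (f g) <-> segment a b g) ->
  dimension_map a b d -> dimension_map a' b' (fun A => d (f @^-1` A)).
Proof.
move=> fK f'K fp fi fs [d0 dP].
have pre A : tau a' b' A -> tau a b (f @^-1` A) by exact: tau_preimage fs.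
split=> [A nA|A1 A2 t1 t2 s12].
  apply: d0 => tA; apply: nA.
  rewrite (_ : A = f' @^-1` (f @^-1` A)); last first.
    by rewrite eqEsubset; split=> g /=; rewrite f'K.
  apply: (@tau_preimage f' f (- k)) tA => //.
  - by move=> g; rewrite -{2}(f'K g) fp; lia.
  - by move=> p g; apply: (can_inj fK); rewrite fi !f'K.
  - by move=> g; rewrite -fs f'K.
rewrite (dP _ _ (pre _ t1) (pre _ t2)); last by move=> g; exact: s12.
congr (_ + _); rewrite -(@card_preimage f f' (A2 `\` A1) fK f'K)//.
by have /commensP[] := tau_commens t2 t1.
Qed.

Lemma segment_mono (f : G -> G) (F : breve G -> breve G) a b :
  (forall g, F (Fin g) = Fin (f g)) ->
  (forall a b, ltB (F a) (F b) <-> ltB a b) ->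
  forall g, segment (F a) (F b) (f g) <-> segment a b g.
Proof. by move=> Ff Fm g; rewrite /segment /= -Ff !leB_ltNge !Fm. Qed.

Lemma bmax_mono (F : breve G -> breve G) a b :
  (forall a b, ltB (F a) (F b) <-> ltB a b) -> bmax (F a) (F b) = F (bmax a b).
Proof.
move=> Fm; have := Fm a b; rewrite /bmax !leBb.
by case: asboolP => ?; case: asboolP => //=; tauto.
Qed.

Lemma bmin_mono (F : breve G -> breve G) a b :
  (forall a b, ltB (F a) (F b) <-> ltB a b) -> bmin (F a) (F b) = F (bmin a b).
Proof.
move=> Fm; have := Fm a b; rewrite /bmin !leBb.
by case: asboolP => ?; case: asboolP => //=; tauto.
Qed.

Lemma bact_mono g a b : ltB (bact g a) (bact g b) <-> ltB a b.
Proof.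
rewrite /ltB; case: a => [x|n]; case: b => [y|m]; rewrite /= ?raddfD /=; try lia.
have E : g + y - (g + x) = y - x by rewrite opprD addrACA subrr add0r.
rewrite /gltG E !raddfD /=.
have [e|e] := pselect (prj G x = prj G y); last lia.
by rewrite e !ltxx; split=> -[//|[_ [//|[_ X]]]]; right; split=> //; right.
Qed.

Lemma prj_gdiam m g : prj G (gdiam m g) = prj G g.
Proof. by rewrite /gdiam raddfD /= prj_inc addr0. Qed.

Lemma bdiam_mono m a b : ltB (bdiam m a) (bdiam m b) <-> ltB a b.
Proof.
rewrite /ltB; case: a => [x|n]; case: b => [y|k]; rewrite /= ?prj_gdiam //.
rewrite /gltG !prj_gdiam.
have [e|e] := pselect (prj G x = prj G y); last lia.
by rewrite /gdiam e opprD addrACA subrr addr0.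
Qed.

Lemma bactD g h a : bact g (bact h a) = bact (g + h) a.
Proof. by case: a => [x|n] /=; rewrite ?raddfD /= addrA. Qed.

Lemma gdiamK m : cancel (gdiam m : G -> G) (gdiam (- m)).
Proof.
move=> g; rewrite {1}/gdiam prj_gdiam /gdiam -addrA -raddfD /=.
by rewrite mulNr subrr raddf0 addr0.
Qed.

End Order.

Section Torsors.
Context {G : extension}.
Implicit Types (g : G) (a b c : breve G) (A : set G).

Lemma tors_eq a b (h1 h2 : tors a b) : (h1 : set G -> int) = h2 -> h1 = h2.
Proof.
case: h1 h2 => [f1 p1] [f2 p2] /= e; rewrite -e in p2 *.
by congr Tors; exact: Prop_irrelevance.
Qed.

(* The action of Z on [a, b], opposite to the one on [b, a] when a < b. *)
Definition tact_fun a b (x : int) (h : tors a b) (A : set G) : int :=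
  if `[< tau (bmax a b) (bmin a b) A >]
  then h A + (if `[< leB b a >] then x else - x) else 0.

Lemma tact_subproof a b x (h : tors a b) :
  dimension_map (bmax a b) (bmin a b) (tact_fun x h).
Proof.
split=> [A nA|A1 A2 t1 t2 s12]; first by rewrite /tact_fun asboolF.
by rewrite /tact_fun (asboolT t1) (asboolT t2) ((torsP h).2 _ _ t1 t2 s12) addrAC.
Qed.

Definition tact a b x (h : tors a b) : tors a b := Tors (tact_subproof x h).

Lemma tdual_subproof a b (h : tors a b) : dimension_map (bmax b a) (bmin b a) h.
Proof. by rewrite bmaxC bminC; exact: torsP. Qed.

(* The identity of underlying sets [a, b] = [b, a]^*; only meaningful for
   a <> b, since [a, a] is identified with Z and not with Z^*. *)
Definition tdual a b (h : tors a b) : tors b a := Tors (tdual_subproof h).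

Lemma ttrans_subproof g a b (h : tors a b) :
  dimension_map (bmax (bact g a) (bact g b)) (bmin (bact g a) (bact g b))
    (fun A => h [set x | A (g + x)]).
Proof.
have m := @bact_mono G g; rewrite (bmax_mono _ _ m) (bmin_mono _ _ m).
apply: (@dimension_map_preimage _ (+%R g) (+%R (- g)) (prj G g)) (torsP h).
- exact: addKr.
- exact: addNKr.
- by move=> x; rewrite raddfD addrC.
- by move=> p x; rewrite addrCA.
- exact: (segment_mono _ _ _ m).
Qed.

Definition ttrans g a b (h : tors a b) : tors (bact g a) (bact g b) :=
  Tors (ttrans_subproof g h).

Lemma tdiam_subproof m a b (h : tors a b) :
  dimension_map (bmax (bdiam m a) (bdiam m b)) (bmin (bdiam m a) (bdiam m b))
    (fun A => h (gdiam m @^-1` A)).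
Proof.
have M := @bdiam_mono G m; rewrite (bmax_mono _ _ M) (bmin_mono _ _ M).
apply: (@dimension_map_preimage _ (gdiam m) (gdiam (- m)) 0) (torsP h).
- exact: gdiamK.
- by move=> g; rewrite -{1}(opprK m) gdiamK.
- by move=> x; rewrite prj_gdiam addr0.
- by move=> p x; rewrite /gdiam raddfD /= prj_inc add0r addrA.
- exact: (segment_mono _ _ _ M).
Qed.

Definition tdiam m a b (h : tors a b) : tors (bdiam m a) (bdiam m b) :=
  Tors (tdiam_subproof m h).

Definition tcast a a' b b' (ea : a = a') (eb : b = b') (h : tors a b) : tors a' b' :=
  match ea in _ = x, eb in _ = y return tors x y with
  | erefl, erefl => h
  end.

Lemma tcastE a a' b b' (ea : a = a') (eb : b = b') (h : tors a b) :
  tcast ea eb h = h :> (set G -> int).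
Proof. by case: _ / ea; case: _ / eb. Qed.

(* Used for a >= b >= c only, where every element of tau a c is a union A1 `|` A2
   as below. *)
Definition splice a b c (d1 : tors a b) (d2 : tors b c) (d : tors a c) : Prop :=
  forall A1 A2, tau a b A1 -> tau b c A2 -> d (A1 `|` A2) = d1 A1 + d2 A2.

(* h is the composite of h1 and h2. Outside the case a >= b >= c, one of the
   factors or its dual is split, and the resulting P (x) P^* or P^* (x) P is
   contracted to the integer x such that p = x + q. *)
Variant composite a b c (h1 : tors a b) (h2 : tors b c) (h : tors a c) : Prop :=
| composite_abc of leB b a & leB c b & splice h1 h2 h
| composite_acb of leB c a & ltB b c &
    exists (u : tors a c) (v : tors c b) (x : int),
      [/\ splice u v h1, v = tact x (tdual h2) & h = tact x u]
| composite_bac of ltB a b & leB c a &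
    exists (u : tors b a) (v : tors a c) (x : int),
      [/\ splice u v h2, u = tact x (tdual h1) & h = tact x v]
| composite_bca of leB c b & ltB a c &
    exists (u : tors b c) (v : tors c a) (x : int),
      [/\ splice u v (tdual h1), h2 = tact x u & h = tact x (tdual v)]
| composite_cab of ltB a c & leB b a &
    exists (u : tors c a) (v : tors a b) (x : int),
      [/\ splice u v (tdual h2), h1 = tact x v & h = tact x (tdual u)]
| composite_cba of ltB b c & ltB a b & splice (tdual h2) (tdual h1) (tdual h).

Lemma reldimU (R1 R2 A1 A2 B1 B2 : set G) : R1 `&` R2 = set0 ->
  A1 `<=` R1 -> B1 `<=` R1 -> A2 `<=` R2 -> B2 `<=` R2 ->
  commens A1 B1 -> commens A2 B2 ->
  reldim (A1 `|` A2) (B1 `|` B2) = reldim A1 B1 + reldim A2 B2.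
Proof.
move=> R12 A1R B1R A2R B2R c1 c2.
have disj g : R1 g -> R2 g -> False.
  by move=> r1 r2; have : set0 g by rewrite -R12.
suff E X1 X2 Y1 Y2 : X1 `<=` R1 -> Y1 `<=` R1 -> X2 `<=` R2 -> Y2 `<=` R2 ->
    commens X1 Y1 -> commens X2 Y2 ->
    card ((X1 `|` X2) `\` (Y1 `|` Y2)) = card (X1 `\` Y1) + card (X2 `\` Y2).
  by rewrite /reldim !E //; [lia|exact: commens_sym|exact: commens_sym].
move=> s1 s2 s3 s4 d1 d2; have /commensP[f _] := commensU d1 d2.
rewrite (cardID R1 f); congr (_ + _); congr card; rewrite eqEsubset; split=> g.
- move=> [[[X1g|X2g] nY] r1]; first by split=> // ?; apply: nY; left.
  by case: (disj _ r1 (s3 _ X2g)).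
- move=> [X1g nY]; split; last exact: s1.
  split; first by left.
  by case=> // /s4; exact: disj (s1 _ X1g).
- move=> [[[X1g|X2g] nY] r1]; first by case: (r1); exact: s1.
  by split=> // ?; apply: nY; right.
- move=> [X2g nY]; split; last by move=> /disj; apply; exact: s3.
  split; first by right.
  by case=> // /s2 /disj; apply; exact: s3.
Qed.

(* Reference set trivializing [a, b]; proof device only. *)
Definition tref a b : set G := halves `&` segment (bmax a b) (bmin a b).

Lemma tau_tref a b : tau (bmax a b) (bmin a b) (tref a b).
Proof. exact: tau_ref. Qed.

Lemma trefC a b : tref a b = tref b a.
Proof. by rewrite /tref bmaxC bminC. Qed.

Definition tval a b (h : tors a b) : int := h (tref a b).

Lemma torsE a b (h : tors a b) A : tau (bmax a b) (bmin a b) A ->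
  h A = tval h + reldim A (tref a b).
Proof. by move=> tA; exact: dimension_mapE (torsP h) tA (tau_tref a b). Qed.

Lemma tval_inj a b : injective (@tval a b).
Proof.
move=> h1 h2 e; apply/tors_eq/funext => A.
have [tA|nA] := pselect (tau (bmax a b) (bmin a b) A).
  by rewrite (torsE h1 tA) (torsE h2 tA) e.
by rewrite (torsP h1).1 // (torsP h2).1.
Qed.

Definition tmk a b (x : int) : tors a b :=
  Tors (dimension_map_mk x (tau_tref a b)).

Lemma tmkK a b x : tval (tmk a b x) = x.
Proof. by rewrite /tval /= asboolT ?reldim_refl ?addr0 //; exact: tau_tref. Qed.

Definition tsg a b : int := if `[< leB b a >] then 1 else -1.

Lemma tsg1 a b : leB b a -> tsg a b = 1.
Proof. by move=> l; rewrite /tsg asboolT. Qed.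
Lemma tsgN1 a b : ltB a b -> tsg a b = -1.
Proof. by move=> l; rewrite /tsg asboolF // leB_ltNge; apply. Qed.

Lemma tval_act a b x (h : tors a b) : tval (tact x h) = tval h + tsg a b * x.
Proof.
rewrite /tval /= /tact_fun asboolT; last exact: tau_tref.
by rewrite /tsg; case: ifP; lia.
Qed.

Lemma tval_dual a b (h : tors a b) : tval (tdual h) = tval h.
Proof. by rewrite /tval /= trefC. Qed.

Lemma spliceE a b c (d1 : tors a b) (d2 : tors b c) (d : tors a c) :
  leB b a -> leB c b -> splice d1 d2 d <-> tval d = tval d1 + tval d2.
Proof.
move=> ba cb; have ca := leB_trans cb ba.
have eU : tref a c = tref a b `|` tref b c.
  rewrite /tref !bmax_l // !bmin_l // (segmentU ba cb) setIUr //.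
have tab : tau a b (tref a b) by have := tau_tref a b; rewrite bmax_l ?bmin_l.
have tbc : tau b c (tref b c) by have := tau_tref b c; rewrite bmax_l ?bmin_l.
split=> [sp|e A1 A2 t1 t2]; first by rewrite /tval eU sp.
rewrite (torsE d) ?bmax_l ?bmin_l //; last exact: tauU t2.
rewrite (torsE d1) ?bmax_l ?bmin_l // (torsE d2) ?bmax_l ?bmin_l // eU e.
rewrite (reldimU (segmentI a b c)); first by rewrite addrACA.
- by case: t1.
- by case: tab.
- by case: t2.
- by case: tbc.
- exact: tau_commens t1 tab.
- exact: tau_commens t2 tbc.
Qed.

Lemma compositeP a b c (h1 : tors a b) (h2 : tors b c) (h : tors a c) :
  composite h1 h2 h <->
  tsg a c * tval h = tsg a b * tval h1 + tsg b c * tval h2.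
Proof.
split.
- case=> l1 l2.
  + rewrite spliceE // !tsg1 //; [lia|exact: leB_trans l1].
  + have l3 := ltB_leB l2 l1.
    move=> [u [v [x [/(spliceE _ _ _ l1 (ltBW l2)) e1 e2 ->]]]].
    move: e1; rewrite e2 !tval_act tval_dual.
    by rewrite (tsg1 l1) (tsg1 (ltBW l2)) (tsg1 (ltBW l3)) (tsgN1 l2); lia.
  + have l3 := leB_ltB l2 l1.
    move=> [u [v [x [/(spliceE _ _ _ (ltBW l1) l2) e1 e2 ->]]]].
    move: e1; rewrite e2 !tval_act tval_dual.
    by rewrite (tsg1 (ltBW l1)) (tsg1 l2) (tsg1 (ltBW l3)) (tsgN1 l1); lia.
  + have l3 := ltB_leB l2 l1.
    move=> [u [v [x [/(spliceE _ _ _ l1 (ltBW l2)) e1 -> ->]]]].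
    move: e1; rewrite !tval_act !tval_dual.
    by rewrite (tsg1 l1) (tsgN1 l2) (tsgN1 l3); lia.
  + have l3 := leB_ltB l2 l1.
    move=> [u [v [x [/(spliceE _ _ _ (ltBW l1) l2) e1 -> ->]]]].
    move: e1; rewrite !tval_act !tval_dual.
    by rewrite (tsg1 l2) (tsgN1 l1) (tsgN1 l3); lia.
  + have l3 := ltB_trans l2 l1.
    rewrite spliceE; [|exact: ltBW|exact: ltBW].
    by rewrite !tval_dual (tsgN1 l1) (tsgN1 l2) (tsgN1 l3); lia.
case: (leBVlt b a) => ab; case: (leBVlt c b) => bc.
- rewrite !tsg1 //; last exact: leB_trans ab.
  by move=> e; apply: composite_abc => //; apply/spliceE => //; lia.
- case: (leBVlt c a) => ac.
  + rewrite (tsg1 ab) (tsgN1 bc) (tsg1 ac) => e; apply: composite_acb => //.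
    exists (tmk a c (tval h1)), (tmk c b 0), (- tval h2); split.
    * by apply/spliceE; rewrite ?tmkK ?addr0 //; exact: ltBW.
    * apply: tval_inj; rewrite tmkK tval_act tval_dual (tsg1 (ltBW bc)); lia.
    * apply: tval_inj; rewrite tval_act tmkK (tsg1 ac); lia.
  + rewrite (tsg1 ab) (tsgN1 bc) (tsgN1 ac) => e; apply: composite_cab => //.
    exists (tmk c a (tval h2)), (tmk a b 0), (tval h1); split.
    * by apply/spliceE; rewrite ?tmkK ?tval_dual ?addr0 //; exact: ltBW.
    * apply: tval_inj; rewrite tval_act tmkK (tsg1 ab); lia.
    * apply: tval_inj; rewrite tval_act tval_dual tmkK (tsgN1 ac); lia.
- case: (leBVlt c a) => ac.
  + rewrite (tsgN1 ab) (tsg1 bc) (tsg1 ac) => e; apply: composite_bac => //.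
    exists (tmk b a 0), (tmk a c (tval h2)), (- tval h1); split.
    * by apply/spliceE; rewrite ?tmkK ?add0r //; exact: ltBW.
    * apply: tval_inj; rewrite tmkK tval_act tval_dual (tsg1 (ltBW ab)); lia.
    * apply: tval_inj; rewrite tval_act tmkK (tsg1 ac); lia.
  + rewrite (tsgN1 ab) (tsg1 bc) (tsgN1 ac) => e; apply: composite_bca => //.
    exists (tmk b c 0), (tmk c a (tval h1)), (tval h2); split.
    * by apply/spliceE; rewrite ?tmkK ?tval_dual ?add0r //; exact: ltBW.
    * apply: tval_inj; rewrite tval_act tmkK (tsg1 bc); lia.
    * apply: tval_inj; rewrite tval_act tval_dual tmkK (tsgN1 ac); lia.
- have ac := ltB_trans ab bc.
  rewrite (tsgN1 ab) (tsgN1 bc) (tsgN1 ac) => e; apply: composite_cba => //.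
  apply/spliceE; [exact: ltBW|exact: ltBW|rewrite !tval_dual; lia].
Qed.

Lemma composite_ex_uniq a b c (h1 : tors a b) (h2 : tors b c) :
  exists! h : tors a c, composite h1 h2 h.
Proof.
have sgK x y : tsg a c * x = y <-> x = tsg a c * y.
  by rewrite /tsg; case: ifP; lia.
exists (tmk a c (tsg a c * (tsg a b * tval h1 + tsg b c * tval h2))); split.
  by apply/compositeP; rewrite tmkK sgK.
by move=> h /compositeP; rewrite sgK => <-; apply: tval_inj; rewrite tmkK.
Qed.

Lemma composite_ex a b c (h1 : tors a b) (h2 : tors b c) :
  exists h : tors a c, composite h1 h2 h.
Proof. by have [h []] := composite_ex_uniq h1 h2; exists h. Qed.

Definition comp a b c (h1 : tors a b) (h2 : tors b c) : tors a c :=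
  projT1 (cid (composite_ex h1 h2)).

Lemma compP a b c (h1 : tors a b) (h2 : tors b c) : composite h1 h2 (comp h1 h2).
Proof. exact: (projT2 (cid (composite_ex h1 h2))). Qed.

Lemma tval_comp a b c (h1 : tors a b) (h2 : tors b c) :
  tsg a c * tval (comp h1 h2) = tsg a b * tval h1 + tsg b c * tval h2.
Proof. exact/compositeP/compP. Qed.

End Torsors.

Section Groups.
Context {G : extension}.
Implicit Types (g : G) (a : breve G).

Definition tildeG a : Type := {g : G & tors a (bact g a)}.

Definition tilde_mul a (x y : tildeG a) : tildeG a :=
  existT _ (tag x + tag y)
    (comp (tagged x)
       (tcast erefl (bactD (tag x) (tag y) a) (ttrans (tag x) (tagged y)))).

Lemma bdiam_bact0 m g : bdiam m (bact g (MInf 0)) = bact (gdiam m g) (MInf 0).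
Proof. by rewrite /= prj_gdiam. Qed.

Definition tilde_diam (m : int) (x : tildeG (MInf 0)) : tildeG (MInf 0) :=
  existT _ (gdiam m (tag x))
    (tcast erefl (bdiam_bact0 m (tag x)) (tdiam m (tagged x))).

Definition hatG : Type := (tildeG (MInf 0) * int)%type.

Definition hat_mul (x y : hatG) : hatG :=
  (tilde_mul x.1 (tilde_diam x.2 y.1), x.2 + y.2).

End Groups.

Section Coordinates.
Context {G : extension} (s : splitting G).

Lemma bact_oplus (b p n : int) : bact (oplus s b p) (MInf n) = MInf (b + n).
Proof. by rewrite /= raddfD /= splK prj_inc addr0. Qed.

Lemma bact_oplus0 b p : bact (oplus s b p) (MInf 0) = MInf b.
Proof. by rewrite bact_oplus addr0. Qed.

Lemma bact_oplusN b p : bact (oplus s b p) (MInf (- b)) = MInf 0.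
Proof. by rewrite bact_oplus subrr. Qed.

Definition quadrants (b : int) : set G :=
  [set g | exists n p : int, [/\ b <= n <= -1, 0 <= p & g = oplus s n p]].

(* The family d_b, whose existence and uniqueness is [base_family_ex_uniq]. *)
Definition base_family (d : forall b : int, tors (MInf 0 : breve G) (MInf b)) : Prop :=
  [/\ tint (d 0) = 0,
      forall b, b < 0 -> d b (quadrants b) = 0 &
      forall b, 0 < b ->
        tint (comp (d b)
          (tcast (bact_oplus0 b 0) (bact_oplusN b 0)
             (ttrans (oplus s b 0) (d (- b))))) = 0].

Lemma segment_MInf (a b : int) (g : G) :
  segment (MInf a) (MInf b) g <-> b <= prj G g < a.
Proof. by rewrite /segment /= leB_ltNge !ltBE /=; lia. Qed.

Lemma prj_oplus n p : prj G (oplus s n p) = n.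
Proof. by rewrite /oplus raddfD /= splK prj_inc addr0. Qed.

Lemma tau_quadrants b : tau (MInf 0) (MInf b) (quadrants b).
Proof.
split; first by move=> _ [n [p [hn _ ->]]]; apply/segment_MInf; rewrite prj_oplus; lia.
pose Y : set G := [set g | b <= prj G g < 0 /\ g = s (prj G g)].
exists Y.
  split=> [g [hg _]|g /segment_MInf hg]; first exact/segment_MInf.
  exists (s (prj G g)); split; first by rewrite /Y /= !splK.
  by move=> y [[_ ->]] ; rewrite splK => ->.
rewrite (_ : _ `&` _ = quadrants b); first exact: commens_refl.
rewrite eqEsubset; split=> g.
  move=> [[y [p [[hy ey] p0 ->]]] _]; exists (prj G y), p.
  by split; [lia|by []|rewrite /oplus -ey addrC].
move=> [n [p [hn p0 ->]]]; split; last by apply/segment_MInf; rewrite prj_oplus; lia.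
exists (s n), p; split=> //; last by rewrite /oplus addrC.
by rewrite /Y /= splK; split=> //; lia.
Qed.

Lemma tintE (a : breve G) (h : tors a a) : tint h = tval h.
Proof.
by rewrite /tint /tval /tref bmax_l ?bmin_l ?segmentaa ?setI0 //; exact: leBB.
Qed.

Lemma tint_comp (a b : breve G) (h1 : tors a b) (h2 : tors b a) :
  tint (comp h1 h2) = 0 <-> tval h1 = - (tsg a b * tsg b a * tval h2).
Proof.
have := tval_comp h1 h2; rewrite tintE (tsg1 (leBB a)) /tsg.
by case: ifP; case: ifP; lia.
Qed.

Lemma base_negP (b : int) (h : tors (MInf 0 : breve G) (MInf b)) : b < 0 ->
  h (quadrants b) = 0 <-> tval h = - reldim (quadrants b) (tref (MInf 0) (MInf b)).
Proof.
move=> b0; have l : leB (MInf b) (MInf 0 : breve G) by right; left.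
rewrite (torsE h) ?bmax_l ?bmin_l //; [lia|exact: tau_quadrants].
Qed.

Lemma base_family_ex_uniq : exists! d, base_family d.
Proof.
pose dn b : tors (MInf 0 : breve G) (MInf b) :=
  tmk _ _ (- reldim (quadrants b) (tref (MInf 0) (MInf b))).
pose v (b : int) (h : tors (MInf 0 : breve G) (MInf (- b))) : int :=
  - (tsg (MInf 0 : breve G) (MInf b) * tsg (MInf b : breve G) (MInf 0) *
     tval (tcast (bact_oplus0 b 0) (bact_oplusN b 0) (ttrans (oplus s b 0) h))).
pose d b : tors (MInf 0 : breve G) (MInf b) :=
  if b < 0 then dn b else tmk _ _ (if 0 < b then v b (dn (- b)) else 0).
have dneg b : b < 0 -> d b = dn b by rewrite /d => ->.
exists d; split.
  split.
  - by rewrite tintE /d ltxx tmkK.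
  - by move=> b b0; apply/base_negP => //; rewrite dneg // tmkK.
  - move=> b b0; apply/tint_comp; rewrite [d (- b)]dneg; last lia.
    by rewrite /d b0 (_ : (b < 0) = false) ?tmkK //; lia.
move=> e [e0 en ep].
have eneg b : b < 0 -> e b = dn b.
  by move=> b0; apply: tval_inj; rewrite tmkK; apply/base_negP => //; exact: en.
apply: functional_extensionality_dep => b.
case: (ltgtP b 0) => b0.
- by rewrite dneg // eneg.
- apply: tval_inj; have /tint_comp -> := ep b b0.
  rewrite /d b0 (_ : (b < 0) = false) ?tmkK; last lia.
  by rewrite eneg //; lia.
- by rewrite b0; apply: tval_inj; move: e0; rewrite tintE => ->; rewrite /d ltxx tmkK.
Qed.

Lemma base_family_ex : exists d, base_family d.
Proof. by have [d []] := base_family_ex_uniq; exists d. Qed.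

Definition dbase : forall b : int, tors (MInf 0 : breve G) (MInf b) :=
  projT1 (cid base_family_ex).

Lemma dbaseP : base_family dbase.
Proof. exact: (projT2 (cid base_family_ex)). Qed.

Definition to_hat (q : int * int * int * int) : hatG (G := G) :=
  let: (a, b, c, m) := q in
  (existT (fun g => tors (MInf 0) (bact g (MInf 0))) (oplus s b a)
     (tcast erefl (esym (bact_oplus0 b a)) (tact (- c) (dbase b))), m).

End Coordinates.

(* Main.v *)
(** For [f : int -> int] let the epigraph of [f] be the set of all [n (+) p]
    with [f n <= p]. Evaluating the elements of [[(i, -oo), (j, -oo)]] on the
    part of the epigraph with [n] between [i] and [j], with the sign of [i - j],
    identifies this torsor with Z, compatibly with composition. On the epigraph
    of 0 this height sends every [d_b] to 0, so that [(a, b, c, m)] becomes the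
    element over [b (+) a] of height [- c]. Translation by [b (+) a] and [m <>]
    pull the epigraph of 0 back to those of the constant [- a] and of
    [n |-> - m n], and replacing one epigraph by another shifts heights by an
    oriented sum of differences: this is where [a1 b2] and [b2 (b2 - 1) m1 / 2]
    come from. *)

From mathcomp Require Import all_boot all_order all_algebra.
From mathcomp Require Import finmap zify.
From mathcomp Require Import boolp classical_sets functions cardinality.
Require Import Defs.

Set Implicit Arguments.
Unset Strict Implicit.
Unset Printing Implicit Defensive.

Import Order.TTheory GRing.Theory Num.Theory.
Local Open Scope classical_set_scope.
Local Open Scope ring_scope.

Section OrientedSums.
Context {V : zmodType}.
Implicit Types (f F : int -> V) (i j k n : int).

Definition primitive f n : V :=
  match n with
  | Posz k => \sum_(i < k) f (Posz i)
  | Negz k => - \sum_(i < k.+1) f (Negz i)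
  end.

Lemma primitiveS f n : primitive f (n + 1) = primitive f n + f n.
Proof.
case: n => [k|[|k]].
- by rewrite -PoszD addn1 /primitive big_ord_recr.
- by rewrite /= big_ord0 big_ord1 addNr.
- rewrite (_ : Negz k.+1 + 1 = Negz k); last by rewrite !NegzE; lia.
  by rewrite /= [in RHS]big_ord_recr opprD /= addrNK.
Qed.

(* The sum of [f n] over [i <= n < j], or minus that over [j <= n < i]. *)
Definition osum f i j : V := primitive f j - primitive f i.

Lemma osumxx f i : osum f i i = 0.
Proof. exact: subrr. Qed.

Lemma opp_osum f i j : - osum f i j = osum f j i.
Proof. exact: opprB. Qed.

Lemma osum_cat f i j k : osum f i j + osum f j k = osum f i k.
Proof. by rewrite /osum addrC subrKA. Qed.

Lemma osum_recr f i j : osum f i (j + 1) = osum f i j + f j.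
Proof. by rewrite /osum primitiveS addrAC. Qed.

Lemma telescope_osum F f i j :
  (forall n, F (n + 1) = F n + f n) -> osum f i j = F j - F i.
Proof.
move=> FS.
have telescope_nat n (k : nat) : osum f n (n + k%:Z) = F (n + k%:Z) - F n.
  elim: k => [|k IH]; first by rewrite addr0 osumxx subrr.
  by rewrite -addn1 PoszD addrA osum_recr IH FS addrAC.
case: (leP i j) => [ij|/ltW ji].
  by rewrite (_ : j = i + `|j - i|%N); [exact: telescope_nat|lia].
rewrite -opp_osum (_ : i = j + `|i - j|%N); last lia.
by rewrite telescope_nat opprB.
Qed.

Lemma osum_const (x : V) i j : osum (fun=> x) i j = x *~ (j - i).
Proof.
rewrite mulrzBr; apply: (telescope_osum (F := fun n => x *~ n)) => n.
by rewrite mulrzDr.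
Qed.

End OrientedSums.

Definition binz2 (n : int) : int := (n * (n - 1) %/ 2)%Z.

Lemma binz2S n : binz2 (n + 1) = binz2 n + n.
Proof.
rewrite /binz2 (_ : (n + 1) * _ = n * 2 + n * (n - 1)); last lia.
by rewrite divzMDl // addrC.
Qed.

Lemma osum_linear (m i j : int) :
  osum (fun n => m * n) i j = m * (binz2 j - binz2 i).
Proof.
rewrite mulrBr; apply: (telescope_osum (F := fun n => m * binz2 n)) => n.
by rewrite binz2S mulrDr.
Qed.

Section MinusInfinity.
Context {G : extension}.
Implicit Types i j : int.

Lemma leB_MInf i j : leB (MInf i : breve G) (MInf j) <-> i <= j.
Proof. by rewrite leB_ltNge ltBE /=; lia. Qed.

Lemma tsg_MInf i j : tsg (MInf i : breve G) (MInf j) = if j <= i then 1 else -1.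
Proof.
case: ifP => ij; first by rewrite tsg1 //; apply/leB_MInf.
by rewrite tsgN1 // ltBE /=; lia.
Qed.

Lemma bmax_MInf i j : bmax (MInf i : breve G) (MInf j) = MInf (Num.max i j).
Proof.
by case: (leP i j) => ij; [apply: bmax_r|apply: bmax_l]; apply/leB_MInf; lia.
Qed.

Lemma bmin_MInf i j : bmin (MInf i : breve G) (MInf j) = MInf (Num.min i j).
Proof.
by case: (leP i j) => ij; [apply: bmin_r|apply: bmin_l]; apply/leB_MInf; lia.
Qed.

Lemma tsg_osum (f : int -> int) i j :
  tsg (MInf i : breve G) (MInf j) * osum f (Num.min i j) (Num.max i j) =
  osum f j i.
Proof.
rewrite tsg_MInf; case: (leP j i) => [ji|ij]; first by rewrite mul1r.
by rewrite mulN1r opp_osum.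
Qed.

End MinusInfinity.

Section Cardinality.
Context {G : extension}.

Lemma card_image_II (F : nat -> G) k : injective F -> card (F @` `I_k) = k.
Proof.
move=> injF; rewrite /card fset_set_image; last exact: finite_II.
by rewrite card_imfset // fset_set_II card_imfset ?size_enum_ord.
Qed.

Lemma opp_reldim (A B : set G) : - reldim A B = reldim B A.
Proof. exact: opprB. Qed.

End Cardinality.

Section Coordinates.
Context {G : extension} (s : splitting G).
Implicit Types (n p m : int) (g : G).

Definition ker_coord g : int := gco g - gco (s (prj G g)).

Lemma gco_oplus n p : gco (oplus s n p) = p + gco (s n).
Proof. by rewrite /oplus addrC gco_inc. Qed.

Lemma ker_coord_oplus n p : ker_coord (oplus s n p) = p.
Proof. by rewrite /ker_coord gco_oplus prj_oplus addrK. Qed.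

Lemma ker_coordK g : oplus s (prj G g) (ker_coord g) = g.
Proof.
by apply: gco_inj; rewrite ?prj_oplus // gco_oplus /ker_coord subrK.
Qed.

Lemma oplusD n1 p1 n2 p2 :
  oplus s n1 p1 + oplus s n2 p2 = oplus s (n1 + n2) (p1 + p2).
Proof. by rewrite /oplus !raddfD /= addrACA. Qed.

Lemma ker_coordD : {morph ker_coord : g h / g + h}.
Proof.
move=> g h.
by rewrite -[g in LHS]ker_coordK -[h in LHS]ker_coordK oplusD ker_coord_oplus.
Qed.

Lemma ker_coord_gdiam m g :
  ker_coord (gdiam m g) = ker_coord g + m * prj G g.
Proof.
rewrite ker_coordD (_ : inc G _ = oplus s 0 (m * prj G g)).
  by rewrite ker_coord_oplus.
by rewrite /oplus raddf0 add0r.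
Qed.

End Coordinates.

Section Epigraphs.
Context {G : extension} (s : splitting G).
Implicit Types (f : int -> int) (i j k n m : int) (g : G).

Local Notation ker_coord := (ker_coord s).

Definition epigraph f i j : set G :=
  [set g | i <= prj G g < j /\ f (prj G g) <= ker_coord g].

Lemma epigraph_sub f i j : epigraph f i j `<=` segment (MInf j) (MInf i).
Proof. by move=> g [gij _]; apply/segment_MInf. Qed.

Lemma epigraphxx f i : epigraph f i i = set0.
Proof. by rewrite -subset0 => g [gi _]; lia. Qed.

Lemma epigraph_cat f i j k : i <= j <= k ->
  epigraph f i k = epigraph f j k `|` epigraph f i j.
Proof.
move=> ijk; rewrite eqEsubset; split=> g.
  case=> gik fg; case: (ltP (prj G g) j) => gj; [right|left];
    by split=> //; lia.
by case=> -[gij fg]; split=> //; lia.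
Qed.

Lemma epigraph_fibre f n :
  epigraph f n (n + 1) = [set g | prj G g = n /\ f n <= ker_coord g].
Proof.
rewrite eqEsubset; split=> g [gn fg]; last first.
  by split; rewrite /= gn // lexx ltrDl.
have {}gn : prj G g = n by lia.
by rewrite gn in fg.
Qed.

Lemma epigraph_trans f i j g :
  [set h | epigraph f (prj G g + i) (prj G g + j) (g + h)] =
  epigraph (fun n => f (prj G g + n) - ker_coord g) i j.
Proof.
apply/funext => h.
by rewrite /epigraph /= raddfD /= ker_coordD lerD2l ltrD2l lerBlDl.
Qed.

Lemma epigraph_gdiam f i j m :
  gdiam m @^-1` epigraph f i j = epigraph (fun n => f n - m * n) i j.
Proof.
apply/funext => g.
by rewrite /epigraph /= prj_gdiam ker_coord_gdiam lerBlDr.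
Qed.

Lemma quadrants_epigraph i : quadrants s i = epigraph (fun=> 0) i 0.
Proof.
rewrite eqEsubset; split=> g.
  move=> [n [p [ni p0 ->]]]; rewrite /epigraph /= prj_oplus ker_coord_oplus.
  by split=> //; lia.
move=> [gi g0]; exists (prj G g), (ker_coord g).
by rewrite ker_coordK; split=> //; lia.
Qed.

Lemma halves_epigraph i j :
  halves `&` segment (MInf j) (MInf i) = epigraph (fun n => - gco (s n)) i j.
Proof.
rewrite eqEsubset; split=> g.
  by move=> [/= g0 /segment_MInf gij]; split; rewrite // /ker_coord lerDr.
move=> [/= gij g0]; split; last exact/segment_MInf.
by move: g0; rewrite /ker_coord lerDr.
Qed.

Lemma commens_epigraph f f' i j : commens (epigraph f i j) (epigraph f' i j).
Proof.
have finite_epigraphD h h' : finite_set (epigraph h i j `\` epigraph h' i j).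
  apply: (@finite_fibrewise G (MInf j) (MInf i) _
    (fun n => h n + gco (s n)) (fun n => h' n + gco (s n))).
    by move=> g [/epigraph_sub].
  move=> g [[gij hg] nh'g]; have : ker_coord g < h' (prj G g).
    by rewrite ltNge; apply/negP => h'g; apply: nh'g.
  by rewrite /ker_coord in hg *; lia.
by apply/commensP; split; exact: finite_epigraphD.
Qed.

Lemma tau_epigraph f i j : tau (MInf j) (MInf i) (epigraph f i j).
Proof.
apply/tauE; rewrite halves_epigraph.
by split; [exact: epigraph_sub|exact: commens_epigraph].
Qed.

Lemma card_epigraph_fibreD f f' n : f n <= f' n ->
  card (epigraph f n (n + 1) `\` epigraph f' n (n + 1)) = f' n - f n.
Proof.
move=> ff'; pose point (k : nat) := oplus s n (f n + k%:Z).
have point_inj : injective point.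
  by move=> k l /(congr1 ker_coord); rewrite !ker_coord_oplus; lia.
rewrite -[RHS]gez0_abs ?subr_ge0 // -(card_image_II _ point_inj).
congr card; rewrite !epigraph_fibre eqEsubset; split=> g /=.
  move=> [[gn fg] nf'g]; have {}nf'g : ker_coord g < f' n.
    by rewrite ltNge; apply/negP => f'g; apply: nf'g.
  exists `|ker_coord g - f n|%N; first by rewrite /=; lia.
  by rewrite -[RHS](ker_coordK s) gn /point; congr oplus; lia.
move=> [k /= kf' <-]; rewrite prj_oplus ker_coord_oplus.
by split=> [|[_]]; [split=> //; lia|lia].
Qed.

Lemma reldim_epigraph_fibre f f' n :
  reldim (epigraph f n (n + 1)) (epigraph f' n (n + 1)) = f' n - f n.
Proof.
wlog ff' : f f' / f n <= f' n => [fibre_le|].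
  case: (leP (f n) (f' n)) => [|/ltW]; first exact: fibre_le.
  by move=> /fibre_le f'f; rewrite -opp_reldim f'f opprB.
rewrite reldim_sub; first exact: card_epigraph_fibreD.
rewrite !epigraph_fibre => g [gn f'g].
by split=> //; exact: le_trans f'g.
Qed.

Lemma reldim_epigraph f f' i j : i <= j ->
  reldim (epigraph f i j) (epigraph f' i j) = osum (fun n => f' n - f n) i j.
Proof.
move=> ij; rewrite (_ : j = i + `|j - i|%N); last lia.
elim: (`|j - i|%N) => [|k IH].
  by rewrite addr0 !epigraphxx reldim_refl osumxx.
rewrite -addn1 PoszD addrA; set l := i + k%:Z.
have ilS : i <= l <= l + 1 by rewrite /l; lia.
rewrite !(epigraph_cat _ ilS) osum_recr [RHS]addrC -IH -reldim_epigraph_fibre.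
apply: (reldimU (segmentI (MInf (l + 1)) (MInf l) (MInf i)));
  by [exact: epigraph_sub|exact: commens_epigraph].
Qed.

End Epigraphs.

Section Heights.
Context {G : extension} (s : splitting G).
Implicit Types (f : int -> int) (i j k m : int) (g : G).

(* Meaningful when [a] and [b] are points at minus infinity; stated for all
   [a] and [b] to commute with casts. *)
Definition height f (a b : breve G) (h : tors a b) : int :=
  tsg a b * h (epigraph s f (Num.min (bprj a) (bprj b))
                            (Num.max (bprj a) (bprj b))).

Lemma height_cast f (a a' b b' : breve G) (ea : a = a') (eb : b = b')
  (h : tors a b) : height f (tcast ea eb h) = height f h.
Proof. by case: _ / ea; case: _ / eb. Qed.

Lemma tau_epigraph_MInf f i j :
  tau (bmax (MInf i) (MInf j)) (bmin (MInf i) (MInf j))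
      (epigraph s f (Num.min i j) (Num.max i j)).
Proof. by rewrite bmax_MInf bmin_MInf; exact: tau_epigraph. Qed.

Lemma height_change f' f i j (h : tors (MInf i) (MInf j)) :
  height f h = height f' h + osum (fun n => f' n - f n) j i.
Proof.
rewrite /height /= (dimension_mapE (torsP h) (tau_epigraph_MInf f i j)
  (tau_epigraph_MInf f' i j)) mulrDr -(@tsg_osum G) reldim_epigraph //.
by rewrite le_max !ge_min !lexx.
Qed.

Lemma height_tval f i j (h : tors (MInf i) (MInf j)) :
  height f h = tsg (MInf i : breve G) (MInf j) * tval h +
               osum (fun n => - gco (s n) - f n) j i.
Proof.
rewrite (height_change (fun n => - gco (s n))); congr (_ + _).
by rewrite /tval /tref bmax_MInf bmin_MInf (halves_epigraph s).
Qed.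

Lemma height_inj f i j : injective (@height f (MInf i) (MInf j)).
Proof.
move=> h h'; rewrite !height_tval tsg_MInf => /addIr e; apply: tval_inj.
by move: e; case: ifP => _; lia.
Qed.

Lemma height_comp f i j k
    (h1 : tors (MInf i) (MInf j)) (h2 : tors (MInf j) (MInf k)) :
  height f (comp h1 h2) = height f h1 + height f h2.
Proof.
by rewrite !height_tval tval_comp [RHS]addrACA [X in _ = _ + X]addrC osum_cat.
Qed.

Lemma height_tint f i (h : tors (MInf i) (MInf i)) : height f h = tint h.
Proof. by rewrite /height /= minxx maxxx epigraphxx tsg_MInf lexx mul1r. Qed.

Lemma height_act f i j x (h : tors (MInf i) (MInf j)) :
  height f (tact x h) = height f h + x.
Proof.
by rewrite !height_tval tval_act tsg_MInf; case: ifP => _; lia.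
Qed.

Lemma height_trans f g i j (h : tors (MInf i) (MInf j)) :
  height f (ttrans g h) =
  height (fun n => f (prj G g + n) - ker_coord s g) h.
Proof.
rewrite /height /= -addr_minr -addr_maxr epigraph_trans.
by rewrite !tsg_MInf lerD2l.
Qed.

Lemma height_diam f m i j (h : tors (MInf i) (MInf j)) :
  height f (tdiam m h) = height (fun n => f n - m * n) h.
Proof. by rewrite /height /= epigraph_gdiam. Qed.

Local Notation height0 := (height (fun=> 0)).

Lemma height0_trans g i j (h : tors (MInf i) (MInf j)) :
  height0 (ttrans g h) = height0 h + ker_coord s g * (i - j).
Proof.
rewrite height_trans (height_change (fun=> 0)) osum_const.
by rewrite !sub0r opprK mulrzz.
Qed.

Lemma height0_diam m i j (h : tors (MInf i) (MInf j)) :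
  height0 (tdiam m h) = height0 h + m * (binz2 i - binz2 j).
Proof.
rewrite height_diam (height_change (fun=> 0)) -osum_linear.
congr (_ + osum _ _ _).
by apply/funext => n; rewrite !sub0r opprK.
Qed.

Lemma height0_dbase b : height0 (dbase s b) = 0.
Proof.
have [dbase_zero dbase_neg dbase_pos] := dbaseP s.
have height0_neg i : i < 0 -> height0 (dbase s i) = 0.
  move=> i0; rewrite /height /= min_r ?max_l ?(ltW i0) //.
  by rewrite -quadrants_epigraph dbase_neg ?mulr0.
case: (ltgtP b 0) => [/height0_neg //|b0|->]; last by rewrite height_tint.
have := dbase_pos b b0; rewrite -(height_tint (fun=> 0)) height_comp.
rewrite height_cast height0_trans ker_coord_oplus mul0r addr0.
by rewrite (height0_neg (- b)) ?oppr_lt0 // addr0.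
Qed.

End Heights.

Section HatCoordinates.
Context {G : extension} (s : splitting G).
Implicit Types (x y : tildeG (MInf 0 : breve G)) (m : int).

Local Notation height0 := (height s (fun=> 0)).

Lemma tildeG_height_inj x y :
  tag x = tag y -> height0 (tagged x) = height0 (tagged y) -> x = y.
Proof.
case: x y => [g h] [g' h'] /= e; case: _ / e h' => h'.
by move=> /(@height_inj _ _ _ 0 _) ->.
Qed.

Lemma height0_tilde_mul x y :
  height0 (tagged (tilde_mul x y)) =
  height0 (tagged x) + height0 (tagged y) - ker_coord s (tag x) * prj G (tag y).
Proof.
case: x y => [g h] [g' h'].
apply: etrans (height_comp _ _ _ _) _; rewrite height_cast /= -addrA.
congr (_ + _); apply: etrans (height0_trans s g h') _.
by congr (_ + _); rewrite addr0 sub0r mulrN.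
Qed.

Lemma height0_tilde_diam m x :
  height0 (tagged (tilde_diam m x)) =
  height0 (tagged x) - binz2 (prj G (tag x)) * m.
Proof.
case: x => [g h]; apply: etrans (height_cast _ _ _ _ _) _.
apply: etrans (height0_diam s m h) _.
by congr (_ + _); rewrite addr0 mulrC -opprB subr0 mulNr.
Qed.

Definition hat_coords (x : hatG (G := G)) : int * int * int * int :=
  (ker_coord s (tag x.1), prj G (tag x.1), - height0 (tagged x.1), x.2).

Definition coords_mul (q1 q2 : int * int * int * int) : int * int * int * int :=
  let: (a1, b1, c1, m1) := q1 in
  let: (a2, b2, c2, m2) := q2 in
  (a1 + a2 + m1 * b2, b1 + b2, c1 + c2 + a1 * b2 + binz2 b2 * m1, m1 + m2).

Lemma height0_to_hat a b c m : height0 (tagged (to_hat s (a, b, c, m)).1) = - c.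
Proof.
apply: etrans (height_cast _ _ _ _ _) _.
by rewrite height_act height0_dbase add0r.
Qed.

Lemma to_hatK : cancel (to_hat s) hat_coords.
Proof.
move=> [[[a b] c] m]; rewrite /hat_coords height0_to_hat opprK.
by rewrite /= ker_coord_oplus prj_oplus.
Qed.

Lemma hat_coordsK : cancel hat_coords (to_hat s).
Proof.
move=> [x m]; congr pair; apply: tildeG_height_inj; first exact: ker_coordK.
by apply: etrans (height0_to_hat _ _ _ m) _; rewrite opprK.
Qed.

Lemma hat_coordsM : {morph hat_coords : x y / hat_mul x y >-> coords_mul x y}.
Proof.
move=> [x m1] [y m2]; rewrite /hat_coords height0_tilde_mul height0_tilde_diam.
rewrite /= (raddfD (prj G)) /= prj_gdiam ker_coordD ker_coord_gdiam.
by congr (_, _, _, _); lia.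
Qed.

End HatCoordinates.

Theorem theorem3 (G : extension) (s : splitting G) :
  bijective (to_hat s) /\
  forall a1 b1 c1 m1 a2 b2 c2 m2 : int,
    hat_mul (to_hat s (a1, b1, c1, m1)) (to_hat s (a2, b2, c2, m2)) =
    to_hat s (a1 + a2 + m1 * b2, b1 + b2,
              c1 + c2 + a1 * b2 + (b2 * (b2 - 1) %/ 2)%Z * m1, m1 + m2).
Proof.
split; first by exists (hat_coords s); [exact: to_hatK|exact: hat_coordsK].
move=> a1 b1 c1 m1 a2 b2 c2 m2.
by rewrite -[LHS](hat_coordsK s) hat_coordsM !to_hatK.
Qed.
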